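(* For all integers $d\geq 2$ and $k\geq 1$, we have $N_{d\text{-ary}}^{\mathrm{con}}(k)=d^{k-1}+k-1$.
   Context: Let $d\geq 2$ be an integer. A $d$-ary plane tree is either an empty tree or a root vertex with $d$ subtrees that are linearly ordered from left to right and are themselves $d$-ary plane trees (the subtrees of a vertex may be empty). The $i$-th subtree of a vertex is the $i$-th from the left; an edge has type $i$ if it connects a vertex to the root of its $i$-th subtree. Isomorphism of $d$-ary plane trees preserves the root and the types of edges. Every connected induced subgraph $T^*$ of a $d$-ary plane tree $\mathcal T$ is viewed as a $d$-ary plane tree (its root is its vertex closest to the root of $\mathcal T$, and edges keep their types). If $T^*$ is isomorphic as a $d$-ary plane tree to a $d$-ary plane tree $T$, then $T^*$ is called a contiguous embedding of $T$ in $\mathcal T$, and $\mathcal T$ is said to contiguously contain $T$. $N_{d\text{-ary}}^{\mathrm{con}}(k)$ denotes the minimum number of vertices in a $d$-ary plane tree that contiguously contains every $d$-ary plane tree with $k$ vertices. *)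

(* Defs.v *)
From HB Require Import structures.
From mathcomp Require Import all_boot.

Set Implicit Arguments.
Unset Strict Implicit.
Unset Printing Implicit Defensive.

(* The exponent [^ d] is the type of finite functions {ffun 'I_d -> dtree d}, *)
(* so Leibniz equality of trees is structural equality.                       *)
Inductive dtree (d : nat) : Type :=
  | Empty
  | Node of dtree d ^ d.

Arguments Empty {d}.

(* A vertex is named by the sequence of the types of the edges on the path    *)
(* from the root down to it; the root itself is [::].                         *)
Fixpoint addresses (d : nat) (t : dtree d) : seq (seq 'I_d) :=
  match t with
  | Empty => [::]
  | Node f =>
      [::] :: flatten [seq [seq i :: p | p <- addresses (f i)] | i <- enum 'I_d]
  end.

Definition vertex (d : nat) (t : dtree d) : finType := seq_sub (addresses t).

Definition num_vertices (d : nat) (t : dtree d) : nat := #|vertex t|.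

Definition depth (d : nat) (t : dtree d) (x : vertex t) : nat := size (val x).

Definition is_root (d : nat) (t : dtree d) (x : vertex t) : bool :=
  val x == [::].

(* [x] is the parent of [y]. *)
Definition edge (d : nat) (t : dtree d) (i : 'I_d) (x y : vertex t) : bool :=
  val y == rcons (val x) i.

Definition adjacent (d : nat) (t : dtree d) (x y : vertex t) : bool :=
  [exists i : 'I_d, edge i x y || edge i y x].

Definition connected_induced (d : nat) (t : dtree d) (S : {set vertex t}) :
    Prop :=
  {in S &, forall x y,
    connect (fun u v => [&& u \in S, v \in S & adjacent u v]) x y}.

Definition is_root_of (d : nat) (t : dtree d) (S : {set vertex t})
    (x : vertex t) : Prop :=
  x \in S /\ {in S, forall y, depth x <= depth y}.

(* [phi] is an isomorphism from [T] onto the subgraph of [U] induced by [S],  *)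
(* rooted at its vertex closest to the root of [U].                           *)
Definition is_isomorphism (d : nat) (T U : dtree d) (S : {set vertex U})
    (phi : vertex T -> vertex U) : Prop :=
  [/\ injective phi,
      [set phi x | x in [set: vertex T]] = S,
      forall r : vertex T, is_root r -> is_root_of S (phi r)
    & forall (i : 'I_d) (x y : vertex T), edge i (phi x) (phi y) = edge i x y].

Definition contiguous_embedding (d : nat) (T U : dtree d)
    (S : {set vertex U}) : Prop :=
  connected_induced S /\
  exists phi : vertex T -> vertex U, is_isomorphism S phi.

Definition contiguously_contains (d : nat) (U T : dtree d) : Prop :=
  exists S : {set vertex U}, contiguous_embedding T S.

Definition contiguously_universal (d k : nat) (U : dtree d) : Prop :=
  forall T : dtree d, num_vertices T = k -> contiguously_contains U T.

(* [n] is the minimum number of vertices of a [d]-ary plane tree that         *)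
(* contiguously contains all [d]-ary plane trees with [k] vertices.           *)
Definition is_N_con (d k n : nat) : Prop :=
  (exists U : dtree d, contiguously_universal k U /\ num_vertices U = n) /\
  (forall U : dtree d, contiguously_universal k U -> n <= num_vertices U).

(* Main.v *)
Require Import Defs.
From HB Require Import structures.
From mathcomp Require Import all_boot zify.

Set Implicit Arguments.
Unset Strict Implicit.
Unset Printing Implicit Defensive.

(** A tree is the prefix-closed set of the addresses of its vertices, and a
nonempty [T] is contiguously contained in [U] exactly when some translate
[r ++ p], for [p] among the addresses of [T], lies in [U]
([contiguously_containsP]).

Lower bound ([universal_lower_bound]).  Each word [w] of length [k - 1] over
the [d] edge types is the address of the end of a path with [k] vertices, so a
universal tree has a vertex whose address ends in [w].  Distinct words give
distinct vertices, whence [d ^ (k - 1)] vertices of depth at least [k - 1];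
the ancestors of any one of them include [k - 1] vertices of smaller depths
[0, ..., k - 2].

Upper bound.  For equality the ending of length [k - 1] must determine every
vertex of depth at least [k - 1].  For [k >= 2] the tree [broom] achieves this:
a spine of [k - 1] vertices whose edges all have a fixed type [o], where the
last vertex of the spine carries a leaf as its subtree of type [o] and a complete
tree with [k - 1] levels as each of its other [d - 1] subtrees.  A tree with
[k] vertices which is not a path has at most [k - 1] levels, so it sits at the
top of one of the complete trees.  A path starts with some number of edges of
type [o], which are matched with the end of the spine, and the rest of it runs
down a complete tree; if all its edges have type [o], it is the spine followed by
the leaf. *)

(** * Addresses of vertices *)

(** The automatically generated principle gives no induction hypothesis for the
subtrees, which are nested inside a finite function. *)
Lemma dtree_nested_ind d (P : dtree d -> Prop) :
  P Empty -> (forall f : {ffun 'I_d -> dtree d}, (forall i, P (f i)) -> P (Node f)) ->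
  forall t, P t.
Proof.
move=> P0 PN.
exact: (fix ind t : P t :=
  match t with Empty => P0 | Node f => PN f (fun i => ind (f i)) end).
Qed.

Lemma nil_addresses d (f : {ffun 'I_d -> dtree d}) : [::] \in addresses (Node f).
Proof. by rewrite inE. Qed.

Lemma cons_addresses d (f : {ffun 'I_d -> dtree d}) i p :
  (i :: p \in addresses (Node f)) = (p \in addresses (f i)).
Proof.
rewrite /= inE /=; apply/flatten_mapP/idP => [[j _ /mapP[q q_in [-> ->]]] //|p_in].
by exists i; rewrite ?mem_enum // map_f.
Qed.

Lemma addresses_uniq d (t : dtree d) : uniq (addresses t).
Proof.
elim/dtree_nested_ind: t => //= f IH; apply/andP; split.
  by apply/flatten_mapP => -[i _ /mapP[]].
apply: (@allpairs_uniq_dep _ _ _ (fun i p => i :: p)); first exact: enum_uniq.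
  by move=> i _; exact: IH.
by move=> [i p] [j q] _ _ /= [<- <-].
Qed.

Lemma num_verticesE d (t : dtree d) : num_vertices t = size (addresses t).
Proof. exact/card_seq_sub/addresses_uniq. Qed.

Lemma num_vertices_Empty d : num_vertices (@Empty d) = 0.
Proof. by rewrite num_verticesE. Qed.

Lemma num_vertices_Node d (f : {ffun 'I_d -> dtree d}) :
  num_vertices (Node f) = (\sum_i num_vertices (f i)).+1.
Proof.
rewrite num_verticesE /= size_flatten /shape -map_comp sumnE big_map big_enum.
by congr _.+1; apply: eq_bigr => i _; rewrite num_verticesE /= size_map.
Qed.

Lemma prefix_closed d (t : dtree d) p q :
  p ++ q \in addresses t -> p \in addresses t.
Proof.
elim/dtree_nested_ind: t p => // f IH [|i p]; first by rewrite nil_addresses.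
by rewrite cat_cons !cons_addresses => /IH.
Qed.

Definition prefixes (A : eqType) (w : seq A) : seq (seq A) :=
  [seq take j w | j <- iota 0 (size w).+1].

Lemma prefixes_uniq (A : eqType) (w : seq A) : uniq (prefixes w).
Proof.
rewrite map_inj_in_uniq ?iota_uniq // => i j; rewrite !mem_iota => ltiw ltjw.
by move=> /(congr1 size); rewrite !size_takel //; lia.
Qed.

Lemma prefixes_addresses d (t : dtree d) w :
  w \in addresses t -> {subset prefixes w <= addresses t}.
Proof.
move=> w_in _ /mapP[j _ ->].
by apply: (@prefix_closed _ _ _ (drop j w)); rewrite cat_take_drop.
Qed.

Lemma size_address_lt d (t : dtree d) w :
  w \in addresses t -> size w < num_vertices t.
Proof.
move=> /prefixes_addresses/(uniq_leq_size (prefixes_uniq w)).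
by rewrite num_verticesE size_map size_iota.
Qed.

(** When the vertices above [w], together with [w] itself, exhaust the vertex
count, nothing is left for the tree off the path leading to [w]. *)
Lemma path_if_deep d (t : dtree d) w p :
  w \in addresses t -> num_vertices t <= (size w).+1 ->
  p \in addresses t -> exists q, w = p ++ q.
Proof.
move=> w_in; rewrite num_verticesE => size_t.
have [|_ <-] := uniq_min_size (prefixes_uniq w) (prefixes_addresses w_in).
  by rewrite size_map size_iota.
by case/mapP=> j _ ->; exists (drop j w); rewrite cat_take_drop.
Qed.

(** * Contiguous containment as translation of addresses *)

Lemma edge_val d (t : dtree d) i (x y : vertex t) :
  edge i x y -> val y = rcons (val x) i.
Proof. by move/eqP. Qed.

Lemma contiguously_contains_translate d (T U : dtree d) :
  [::] \in addresses T -> contiguously_contains U T ->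
  exists r, forall p, p \in addresses T -> r ++ p \in addresses U.
Proof.
move=> T0 [S [_ [phi [_ _ _ phi_edge]]]].
exists (val (phi (SeqSub T0))) => p pT.
suff <- : val (phi (SeqSub pT)) = val (phi (SeqSub T0)) ++ p by apply: valP.
elim/last_ind: p pT => [|p i IH] pT.
  by rewrite cats0 (bool_irrelevance pT T0).
have p'T : p \in addresses T by apply: (@prefix_closed _ _ _ [:: i]); rewrite cats1.
rewrite -rcons_cat -(IH p'T); apply: edge_val.
by rewrite phi_edge /edge /=.
Qed.

Lemma translate_contiguously_contains d (T U : dtree d) r :
  [::] \in addresses T -> (forall p, p \in addresses T -> r ++ p \in addresses U) ->
  contiguously_contains U T.
Proof.
move=> T0 rU.
pose phi (x : vertex T) : vertex U := SeqSub (rU (val x) (valP x)).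
have phiE x : val (phi x) = r ++ val x by [].
pose S : {set vertex U} := [set phi x | x in [set: vertex T]].
have phiS x : phi x \in S by apply: imset_f; rewrite inE.
exists S; split; last first.
  exists phi; split => //.
  - move=> x y /(congr1 val); rewrite !phiE => /eqP.
    by rewrite eqseq_cat // eqxx /= => /eqP/val_inj.
  - move=> x /eqP x0; split=> // _ /imsetP[y _ ->].
    by rewrite /depth !phiE !size_cat x0 leq_add2l.
  - by move=> i x y; rewrite /edge !phiE rcons_cat eqseq_cat // eqxx.
pose e : rel (vertex U) := fun u v => [&& u \in S, v \in S & adjacent u v].
have e_sym : connect_sym e.
  apply: sym_connect_sym => u v; rewrite /e /adjacent andbCA.
  by do 2!congr (_ && _); apply: eq_existsb => i; rewrite orbC.
(* The copy is connected because each of its vertices is joined to the root of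
   the copy along its ancestors. *)
have conn x : connect e (phi (SeqSub T0)) (phi x).
  case: x => p pT; elim/last_ind: p pT => [|p i IH] pT.
    by rewrite (bool_irrelevance pT T0).
  have p'T : p \in addresses T by apply: (@prefix_closed _ _ _ [:: i]); rewrite cats1.
  apply: connect_trans (IH p'T) (connect1 _).
  rewrite /e !phiS /=; apply/existsP; exists i; apply/orP; left.
  by rewrite /edge !phiE /= rcons_cat.
move=> _ _ /imsetP[x _ ->] /imsetP[y _ ->].
by apply: (connect_trans _ (conn y)); rewrite -/e e_sym.
Qed.

(** The type-preserving map is determined by the image [r] of the root, since
each vertex is reached from the root by following its address. *)
Lemma contiguously_containsP d (T U : dtree d) :
  [::] \in addresses T ->
  contiguously_contains U T <->
  exists r, forall p, p \in addresses T -> r ++ p \in addresses U.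
Proof.
move=> T0; split; first exact: contiguously_contains_translate.
by case=> r; apply: translate_contiguously_contains.
Qed.

(** * The lower bound *)

Definition leaf d : dtree d := Node [ffun=> Empty].

Lemma num_vertices_leaf d : num_vertices (leaf d) = 1.
Proof.
rewrite num_vertices_Node big1 // => i _.
by rewrite ffunE num_vertices_Empty.
Qed.

Fixpoint path_tree d (w : seq 'I_d) : dtree d :=
  if w is i :: w' then Node [ffun j => if j == i then path_tree w' else Empty]
  else leaf d.

Lemma num_vertices_path_tree d (w : seq 'I_d) :
  num_vertices (path_tree w) = (size w).+1.
Proof.
elim: w => [|i w IH] /=; first exact: num_vertices_leaf.
rewrite num_vertices_Node (bigD1 i) //= ffunE eqxx IH big1 ?addn0 // => j.
by rewrite ffunE => /negPf->; rewrite num_vertices_Empty.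
Qed.

Lemma path_tree_end d (w : seq 'I_d) : w \in addresses (path_tree w).
Proof.
elim: w => [|i w IH]; first exact: nil_addresses.
by rewrite [path_tree _]/= cons_addresses ffunE eqxx.
Qed.

Lemma universal_address_ending d k (U : dtree d) w :
  contiguously_universal k.+1 U -> size w = k -> exists r, r ++ w \in addresses U.
Proof.
move=> univU size_w.
have root_in : [::] \in addresses (path_tree w).
  exact: (@prefix_closed _ _ [::] w (path_tree_end w)).
have /(contiguously_containsP _ root_in)[r rU] : contiguously_contains U (path_tree w).
  by apply: univU; rewrite num_vertices_path_tree size_w.
by exists r; apply/rU/path_tree_end.
Qed.

(** The vertices of depth at least [k] are counted by the last [k] letters of
their addresses, which take all possible values; those of smaller depth by the
ancestors of one deep vertex. *)
Lemma universal_lower_bound d k (U : dtree d) :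
  0 < d -> contiguously_universal k.+1 U -> d ^ k + k <= num_vertices U.
Proof.
move=> d_gt0 univU.
rewrite num_verticesE -(count_predC (fun p => k <= size p)) -!size_filter.
apply: leq_add.
- pose ending (p : seq 'I_d) := drop (size p - k) p.
  rewrite -(size_map ending).
  have <- : size [seq val w | w <- enum {: k.-tuple 'I_d}] = d ^ k.
    by rewrite size_map -cardE card_tuple card_ord.
  apply: uniq_leq_size; first by rewrite map_inj_uniq ?enum_uniq //; apply: val_inj.
  move=> _ /mapP[w _ ->]; have [r rwU] := universal_address_ending univU (size_tuple w).
  apply/mapP; exists (r ++ w).
    by rewrite mem_filter rwU size_cat size_tuple leq_addl.
  by rewrite /ending size_cat size_tuple addnK drop_size_cat.
(* Any word of length [k] would do to get a vertex of depth at least [k]. *)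
- have [r] := universal_address_ending univU (size_nseq k (Ordinal d_gt0)).
  set q := r ++ _ => qU; have size_q : k <= size q by rewrite size_cat size_nseq leq_addl.
  have {1}<- : size [seq take j q | j <- iota 0 k] = k by rewrite size_map size_iota.
  apply: uniq_leq_size.
    rewrite map_inj_in_uniq ?iota_uniq // => i j; rewrite !mem_iota => ltik ltjk.
    by move=> /(congr1 size); rewrite !size_takel //; lia.
  move=> _ /mapP[j /[!mem_iota] /= ltjk ->]; rewrite mem_filter /=.
  have ltjq : j < size q by apply: leq_trans size_q.
  rewrite size_takel ?(ltnW ltjq) // -ltnNge ltjk /=.
  by apply: (prefixes_addresses qU); apply/mapP; exists j; rewrite // mem_iota /= ltnS ltnW.
Qed.

(** * A universal tree of minimum size *)

Fixpoint complete d h : dtree d :=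
  if h is h'.+1 then Node [ffun=> complete d h'] else Empty.

Lemma complete_addresses d h (p : seq 'I_d) :
  (p \in addresses (complete d h)) = (size p < h).
Proof.
elim: h p => [|h IH] [|i p] //.
by rewrite [complete _ _]/= cons_addresses ffunE IH.
Qed.

Lemma num_vertices_complete d h :
  0 < d -> (d.-1 * num_vertices (complete d h)).+1 = d ^ h.
Proof.
case: d => // d _ /=; elim: h => [|h IH]; first by rewrite num_vertices_Empty muln0.
rewrite [complete _ _]/= num_vertices_Node.
under eq_bigr do rewrite ffunE.
rewrite sum_nat_const card_ord expnS -IH; nia.
Qed.

(** The spine has [n] edges.  In the minimum universal tree, where
[h = n + 1], the subtree of type [o] at its last vertex is only a leaf because
any vertex below that leaf would repeat an ending of length [h] that occurs
elsewhere. *)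
Fixpoint broom d (o : 'I_d) h n : dtree d :=
  if n is n'.+1 then Node [ffun i => if i == o then broom o h n' else Empty]
  else Node [ffun i => if i == o then leaf d else complete d h].

Lemma num_vertices_broom d (o : 'I_d) h n : num_vertices (broom o h n) = d ^ h + n.+1.
Proof.
have d_gt0 : 0 < d by exact: leq_ltn_trans (ltn_ord o).
elim: n => [|n IH]; rewrite [broom _ _ _]/= num_vertices_Node (bigD1 o) //= ffunE eqxx.
  rewrite num_vertices_leaf -(num_vertices_complete h d_gt0).
  rewrite (eq_bigr (fun=> num_vertices (complete d h))); last first.
    by move=> i /negPf io; rewrite ffunE io.
  by rewrite sum_nat_const cardC1 card_ord; lia.
rewrite IH big1 => [|i /negPf io]; first by lia.
by rewrite ffunE io num_vertices_Empty.
Qed.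

Lemma broom_spine d (o : 'I_d) h n m p :
  (nseq m o ++ p \in addresses (broom o h (m + n))) = (p \in addresses (broom o h n)).
Proof.
by elim: m => // m IH; rewrite [broom _ _ _]/= cons_addresses ffunE eqxx.
Qed.

(** The spine has to be as long as the initial run of [o] in [w], except that
the final letter of a word consisting only of [o] leads to the leaf. *)
Lemma broom_short_spine d (o : 'I_d) h (w : seq 'I_d) :
  0 < size w <= h -> exists2 n, n < size w & w \in addresses (broom o h n).
Proof.
elim: w => // i w IH /= size_w.
have [->|io] := eqVneq i o; last first.
  by exists 0; rewrite // cons_addresses ffunE (negPf io) complete_addresses.
case: w IH size_w => [_ _|j w IH size_w].
  by exists 0; rewrite // cons_addresses ffunE eqxx nil_addresses.
have [|n ltnw w_in] := IH; first by move: size_w => /=; lia.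
by exists n.+1; rewrite ?ltnS // cons_addresses ffunE eqxx.
Qed.

Lemma broom_universal d (o o' : 'I_d) n :
  o' != o -> contiguously_universal n.+2 (broom o n.+1 n).
Proof.
move=> oo' T size_T.
have T0 : [::] \in addresses T.
  by case: T size_T => [|f] => [|_]; [rewrite num_vertices_Empty | exact: nil_addresses].
apply/(contiguously_containsP _ T0).
have [/hasP[w wT size_w]|/hasPn T_low] := boolP (has (fun p => n < size p) (addresses T)).
  have sizeE : size w = n.+1.
    by apply/eqP; rewrite eqn_leq size_w andbT -ltnS -size_T size_address_lt.
  have [|m] := @broom_short_spine _ o n.+1 w; rewrite sizeE ?leqnn // => le_mn w_in.
  (* A path that uses only the last [m] edges of the spine starts [n - m] steps
     below the root. *)
  exists (nseq (n - m) o) => p pT.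
  have [|q wE] := path_if_deep wT _ pT; first by rewrite size_T sizeE.
  apply: (@prefix_closed _ _ _ q); rewrite -catA -wE.
  by rewrite -[X in broom _ _ X](subnK (n := n) le_mn) broom_spine.
exists (rcons (nseq n o) o') => p pT; rewrite cat_rcons.
rewrite -[X in broom _ _ X]addn0 broom_spine cons_addresses ffunE (negPf oo') complete_addresses ltnS.
by rewrite leqNgt T_low.
Qed.

Theorem theorem2p1 (d k : nat) (hd : 2 <= d) (hk : 1 <= k) :
  is_N_con d k (d ^ (k - 1) + k - 1).
Proof.
have d_gt0 : 0 < d by lia.
case: k hk => // k _; have -> : d ^ (k.+1 - 1) + k.+1 - 1 = d ^ k + k.
  by rewrite subSS subn0; lia.
split; last by move=> U; apply: universal_lower_bound.
case: k => [|n].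
  exists (leaf d); split; last exact: num_vertices_leaf.
  move=> T size_T; case: T size_T => [|f size_f]; first by rewrite num_vertices_Empty.
  apply/(contiguously_containsP _ (nil_addresses f)); exists [::] => p.
  by move/size_address_lt; rewrite size_f; case: p.
exists (broom (Ordinal d_gt0) n.+1 n); split; last exact: num_vertices_broom.
exact: (@broom_universal _ _ (Ordinal hd)).
Qed.
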